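(* Let $\Xi\subseteq\mathbb{R}^d$ be a design space and let $d_{\mathrm{train}}$, $d_{\mathrm{test}}$ be probability densities on $\Xi$ with $d_{\mathrm{train}}(\xi)>0$ for all $\xi\in\Xi$. Let $(\xi,y)$ be distributed with $\xi\sim d_{\mathrm{train}}$ and $y\mid\xi$ drawn from the true data-generating process, and let $f^{\star}(\xi)=\mathbb{E}[y\mid\xi]$ be the true regression function. Let $\mathcal{F}$ be a finite class of functions $\Xi\to\mathbb{R}$, and suppose there is $0<y_{\infty}<\infty$ with $\sup_{f\in\mathcal{F}}\sup_{\xi\in\Xi}|f(\xi)|\le y_\infty$, $\sup_{\xi\in\Xi}|f^{\star}(\xi)|\le y_\infty$ and $|y|\le y_\infty$ almost surely. Let $\bar f=\arg\min_{f\in\mathcal{F}}R_{\mathrm{test}}(f)$, where $R_{\mathrm{test}}(f):=\mathbb{E}_{\xi\sim d_{\mathrm{test}}}[(f(\xi)-f^{\star}(\xi))^2]$. Define $$\mathbb{C}_\infty:=\sup_{\xi\in\Xi}\left|\frac{d_{\mathrm{test}}(\xi)}{d_{\mathrm{train}}(\xi)}\right|,\qquad \mathbb{B}_\infty:=\sup_{\xi\in\Xi}|\bar f(\xi)-f^{\star}(\xi)|.$$ Given $n$ i.i.d. samples $(\xi_i,y_i)_{i=1}^n$ from this training distribution, let $\hat f^{(n)}\in\arg\min_{f\in\mathcal{F}}\frac1n\sum_{i=1}^n(f(\xi_i)-y_i)^2$ be the empirical risk minimizer, and define $$\widehat{\mathbb{A}}(\hat f^{(n)}):=\mathbb{E}_{\xi\sim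 d_{\mathrm{train}}}\big[(\hat f^{(n)}(\xi)-\bar f(\xi))(\bar f(\xi)-f^{\star}(\xi))\big].$$ Then for any $\delta\in(0,1)$, with probability at least $1-\delta$, $$R_{\mathrm{test}}(\hat f^{(n)})\le \mathbb{C}_\infty\cdot\begin{cases}\mathbb{B}_\infty^2+\dfrac{224\,y_\infty^2\log(|\mathcal{F}|/\delta)}{3n}-2\widehat{\mathbb{A}}(\hat f^{(n)}), & \text{if } \widehat{\mathbb{A}}(\hat f^{(n)})<0,\\[2mm] \mathbb{B}_\infty^2+\dfrac{128\,y_\infty^2\log(|\mathcal{F}|/\delta)}{3n}-\sqrt{3}\,\widehat{\mathbb{A}}(\hat f^{(n)}), & \text{if } \widehat{\mathbb{A}}(\hat f^{(n)})\ge 0.\end{cases}$$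
   Context: $d_{\mathrm{train}}$ is the distribution from which training designs are drawn and $d_{\mathrm{test}}$ the distribution on which the predictor is evaluated (covariate shift: the conditional law of $y$ given $\xi$ is the same under both). $|\mathcal{F}|$ is the cardinality of the model class. *)

(* Defs.v *)
From mathcomp Require Import all_boot all_order all_algebra.
From mathcomp Require Import all_classical all_reals all_analysis.
Set Implicit Arguments. Unset Strict Implicit. Unset Printing Implicit Defensive.
Import Order.TTheory GRing.Theory Num.Theory.
Local Open Scope classical_set_scope.
Local Open Scope ring_scope.

Section Defs.
Variable R : realType.

(* The design space lives in R^d, represented as d.-tuple R with its product
   (= Borel) sigma-algebra. *)
Definition tuple_box (d : nat) (a b : d.-tuple R) : set (d.-tuple R) :=
  [set x | forall i : 'I_d, tnth a i < tnth x i <= tnth b i].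

(* mu is Lebesgue measure on R^d: it gives every half-open box its volume
   (this characterizes Lebesgue measure on the Borel sets). *)
Definition is_lebesgue_tuple (d : nat)
    (mu : {measure set (d.-tuple R) -> \bar R}) : Prop :=
  forall a b : d.-tuple R, (forall i : 'I_d, tnth a i <= tnth b i) ->
    mu (tuple_box a b) = (\prod_(i < d) (tnth b i - tnth a i))%:E.

Definition density_on (d : nat) (mu : {measure set (d.-tuple R) -> \bar R})
    (Xi : set (d.-tuple R)) (p : d.-tuple R -> R) : Prop :=
  measurable_fun Xi p /\ (forall x, Xi x -> 0 <= p x) /\
  (\int[mu]_(x in Xi) (p x)%:E = 1)%E.

Definition cond_exp_version (d : nat) (P : probability (d.-tuple R * R)%type R)
    (g : d.-tuple R -> R) : Prop :=
  measurable_fun setT g /\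
  forall A : set (d.-tuple R), measurable A ->
    (\int[P]_(z in A `*` setT) (z.2)%:E = \int[P]_(z in A `*` setT) (g z.1)%:E)%E.

Definition iid_sample (d : nat) dO (O : measurableType dO)
    (Pr : probability O R) (n : nat) (Z : 'I_n -> O -> (d.-tuple R * R)%type)
    (P : probability (d.-tuple R * R)%type R) : Prop :=
  (forall i, measurable_fun setT (Z i)) /\
  (forall i (B : set (d.-tuple R * R)), measurable B -> Pr (Z i @^-1` B) = P B) /\
  (forall B : 'I_n -> set (d.-tuple R * R), (forall i, measurable (B i)) ->
     Pr (\bigcap_(i in [set: 'I_n]) (Z i @^-1` B i)) =
     (\prod_(i < n) Pr (Z i @^-1` B i))%E).

Definition Rtest (d : nat) (mu : {measure set (d.-tuple R) -> \bar R})
    (Xi : set (d.-tuple R)) (dtest fstar f : d.-tuple R -> R) : \bar R :=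
  (\int[mu]_(x in Xi) (((f x - fstar x) ^+ 2) * dtest x)%:E)%E.

Definition Ahat (d : nat) (mu : {measure set (d.-tuple R) -> \bar R})
    (Xi : set (d.-tuple R)) (dtrain fstar fbar g : d.-tuple R -> R) : \bar R :=
  (\int[mu]_(x in Xi) (((g x - fbar x) * (fbar x - fstar x)) * dtrain x)%:E)%E.

Definition Cinf (d : nat) (Xi : set (d.-tuple R)) (dtrain dtest : d.-tuple R -> R)
  : \bar R := ereal_sup [set (`|dtest x / dtrain x|)%:E | x in Xi].

(* B_infty = sup_{xi in Xi} |fbar xi - f* xi| (a bounded set here) *)
Definition Binf (d : nat) (Xi : set (d.-tuple R)) (fstar fbar : d.-tuple R -> R)
  : R := sup [set `|fbar x - fstar x| | x in Xi].

Definition emp_risk (d : nat) dO (O : measurableType dO) (n : nat)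
    (Z : 'I_n -> O -> (d.-tuple R * R)%type) (f : d.-tuple R -> R) (w : O) : R :=
  n%:R^-1 * \sum_(i < n) (f (Z i w).1 - (Z i w).2) ^+ 2.

End Defs.

(* Main.v *)
Require Import Defs.
From mathcomp Require Import all_boot all_order all_algebra.
From mathcomp Require Import all_classical all_reals all_analysis.
From mathcomp Require Import measurable_realfun ring lra.
Import Order.TTheory GRing.Theory Num.Theory.
Import numFieldNormedType.Exports.
Local Open Scope classical_set_scope.
Local Open Scope ring_scope.

(** Writing [f], [g], [s] for the empirical risk minimizer, [fbar], [fstar],
    put [V = E (f - g)^2] and [A = E (f - g)(g - s)] under the training law, so
    that the training risk of [f] is [V + 2 A + E (g - s)^2] and the excess
    loss [U = (f - y)^2 - (g - y)^2] has mean [V + 2 A].  Since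
    [U = (f - g)(f + g - 2 y)], its second moment is at most [16 yinf^2 V]:
    the variance is controlled by [V] and not by the mean.  A Chernoff bound for
    the sample mean of [U] with the fixed parameter [5 / (104 yinf^2)], a union
    bound over the class and the minimality of [f] give
    [V + 4 A < (208 / 5) yinf^2 log (|F| / delta) / n], which implies both
    cases of the theorem as [208 / 5 < 128 / 3 < 224 / 3] and [sqrt 3 <= 2].
    The strict inequality makes the right-hand side positive, which is what
    settles the case [Cinf = +oo]. *)

(** * Change of variables for integrals against weighted image measures *)

Section Transport.
Import HBNNSimple.

(** The simple functions [h n] depend on [g] alone, so the right-hand side sees [m], [H] and [Z]
    only through integrals of [H] over preimages of sets; data that agree on these have equal
    left-hand sides. Monotone convergence applies because [H] is nonnegative and [h n] increases to
    [g]. *)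
Lemma integral_weighted_lim {d d'} {T : measurableType d}
    {S : measurableType d'} {R : realType} (m : {measure set T -> \bar R})
    {H : T -> R} {Z : T -> S} {g : S -> R} (mH : measurable_fun setT H)
    (H0 : forall x, 0 <= H x) (mZ : measurable_fun setT Z)
    (mg : measurable_fun setT (EFin \o g)) (g0 : forall s, 0 <= g s) :
  let h n := nnsfun_approx measurableT mg n in
  (\int[m]_x (H x * g (Z x))%:E =
   limn (fun n => \sum_(y \in range (h n))
     y%:E * \int[m]_x (H x * \1_(h n @^-1` [set y]) (Z x))%:E))%E.
Proof.
move=> h.
have mhZ n : measurable_fun setT (fun x => H x * h n (Z x)).
  by apply: measurable_funM => //; exact: measurableT_comp.
transitivity (limn (fun n => \int[m]_x (H x * h n (Z x))%:E)%E).
  rewrite -monotone_convergence//.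
  - apply: eq_integral => x _; apply/esym/cvg_lim => //.
    under eq_fun do rewrite EFinM.
    rewrite EFinM; apply: cvgeZl => //.
    by apply: (cvg_nnsfun_approx measurableT mg) => // s _; rewrite /= lee_fin.
  - by move=> n; exact/measurable_EFinP.
  - by move=> n x _; rewrite lee_fin mulr_ge0.
  - move=> x _ a b ab; rewrite lee_fin ler_wpM2l//.
    exact/lefP/nd_nnsfun_approx.
apply: congr_lim; apply/funext => n.
have mterm y : measurable_fun setT (fun x => H x * \1_(h n @^-1` [set y]) (Z x)).
  apply: measurable_funM => //.
  apply: measurableT_comp mZ => //.
have int_term y : (\int[m]_x (H x * (y * \1_(h n @^-1` [set y]) (Z x)))%:E =
    y%:E * \int[m]_x (H x * \1_(h n @^-1` [set y]) (Z x))%:E)%E.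
  have [y0|y0] := leP 0 y.
    under eq_integral do rewrite mulrCA EFinM.
    rewrite ge0_integralZl//; first exact/measurable_EFinP.
    by move=> x _; rewrite lee_fin mulr_ge0.
  (* A nonnegative simple function takes no negative value, so for [y < 0] both sides vanish. *)
  have -> : h n @^-1` [set y] = set0 by exact: preimage_nnfun0.
  by rewrite !integral0_eq ?mule0// => x _; rewrite indic0 !mulr0.
transitivity (\int[m]_x (\sum_(y \in range (h n))
    (H x * (y * \1_(h n @^-1` [set y]) (Z x)))%:E))%E.
  apply: eq_integral => x _.
  rewrite fsumEFin//; congr EFin.
  by rewrite [in LHS](fimfunE (h n)) mulr_fsumr.
rewrite ge0_integral_fsum//.
- by apply: eq_fsbigr => y _; exact: int_term.
- move=> y; apply/measurable_EFinP.
  under eq_fun do rewrite mulrCA.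
  exact: measurable_funM.
- move=> y x _; rewrite lee_fin mulr_ge0//.
  by have := nnfun_muleindic_ge0 (h n) y (Z x); rewrite lee_fin.
Qed.

(** Two weighted image measures that agree on sets agree on functions.  This
    serves for the marginal density, for the conditional expectation and, one
    factor at a time, for independence. *)
Lemma ge0_integral_transport {d1 d2 d'} {T1 : measurableType d1}
    {T2 : measurableType d2} {S : measurableType d'} {R : realType}
    (m1 : {measure set T1 -> \bar R}) (m2 : {measure set T2 -> \bar R})
    (H1 : T1 -> R) (H2 : T2 -> R) (Z1 : T1 -> S) (Z2 : T2 -> S) (g : S -> R) :
  measurable_fun setT H1 -> (forall x, 0 <= H1 x) ->
  measurable_fun setT H2 -> (forall x, 0 <= H2 x) ->
  measurable_fun setT Z1 -> measurable_fun setT Z2 ->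
  (forall B : set S, measurable B ->
    \int[m1]_x (H1 x * \1_B (Z1 x))%:E = \int[m2]_x (H2 x * \1_B (Z2 x))%:E)%E ->
  measurable_fun setT g -> (forall s, 0 <= g s) ->
  (\int[m1]_x (H1 x * g (Z1 x))%:E = \int[m2]_x (H2 x * g (Z2 x))%:E)%E.
Proof.
move=> mH1 H10 mH2 H20 mZ1 mZ2 H12 mg g0.
have mg' : measurable_fun setT (EFin \o g) by exact/measurable_EFinP.
rewrite (integral_weighted_lim m1 mH1 H10 mZ1 mg' g0).
rewrite (integral_weighted_lim m2 mH2 H20 mZ2 mg' g0).
apply: congr_lim; apply/funext => n.
by apply: eq_fsbigr => y _; rewrite H12.
Qed.

(** Nonnegative weights factor out of positive and negative parts, and each part is transported
    separately. The identity is one of extended reals, the parts being matched before the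
    subtraction. *)
Lemma integral_transport {d1 d2 d'} {T1 : measurableType d1}
    {T2 : measurableType d2} {S : measurableType d'} {R : realType}
    (m1 : {measure set T1 -> \bar R}) (m2 : {measure set T2 -> \bar R})
    (H1 : T1 -> R) (H2 : T2 -> R) (Z1 : T1 -> S) (Z2 : T2 -> S) (g : S -> R) :
  measurable_fun setT H1 -> (forall x, 0 <= H1 x) ->
  measurable_fun setT H2 -> (forall x, 0 <= H2 x) ->
  measurable_fun setT Z1 -> measurable_fun setT Z2 ->
  (forall B : set S, measurable B ->
    \int[m1]_x (H1 x * \1_B (Z1 x))%:E = \int[m2]_x (H2 x * \1_B (Z2 x))%:E)%E ->
  measurable_fun setT g ->
  (\int[m1]_x (H1 x * g (Z1 x))%:E = \int[m2]_x (H2 x * g (Z2 x))%:E)%E.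
Proof.
move=> mH1 H10 mH2 H20 mZ1 mZ2 H12 mg.
have pos d (T : measurableType d) (m : {measure set T -> \bar R})
      (H : T -> R) (Z : T -> S) :
    (forall x, 0 <= H x) ->
    (\int[m]_x (EFin \o (fun x => H x * g (Z x))%R)^\+ x =
     \int[m]_x (H x * Num.max (g (Z x)) 0)%:E)%E.
  move=> H0; apply: eq_integral => x _.
  by rewrite funeposE /= -EFin_max maxr_pMr// mulr0.
have neg d (T : measurableType d) (m : {measure set T -> \bar R})
      (H : T -> R) (Z : T -> S) :
    (forall x, 0 <= H x) ->
    (\int[m]_x (EFin \o (fun x => H x * g (Z x))%R)^\- x =
     \int[m]_x (H x * Num.max (- g (Z x)) 0)%:E)%E.
  move=> H0; apply: eq_integral => x _.
  by rewrite funenegE /= -EFin_max maxr_pMr// mulr0 mulrN.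
rewrite integralE [RHS]integralE !pos// !neg//; congr (_ - _)%E.
- apply: (@ge0_integral_transport _ _ _ _ _ _ _ _ _ H1 H2 Z1 Z2
    (fun s => Num.max (g s) 0)) => //.
  + exact: measurable_maxr.
  + by move=> s; rewrite le_max lexx orbT.
- apply: (@ge0_integral_transport _ _ _ _ _ _ _ _ _ H1 H2 Z1 Z2
    (fun s => Num.max (- g s) 0)) => //.
  + by apply: measurable_maxr => //; exact: measurableT_comp.
  + by move=> s; rewrite le_max lexx orbT.
Qed.

End Transport.

(** * Expectation of a product under independence *)

Lemma prod_indic_preimage {n : nat} {T S : Type} {R : realType}
    (Z : 'I_n -> T -> S) (B : 'I_n -> set S) (x : T) :
  \prod_(i < n) (\1_(B i) (Z i x) : R) =
  \1_(\bigcap_(i in [set: 'I_n]) (Z i @^-1` B i)) x.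
Proof.
have [xB|xB] := pselect ((\bigcap_(i in [set: 'I_n]) (Z i @^-1` B i)) x).
  rewrite indicE mem_set// big1// => i _.
  by rewrite indicE mem_set//; exact: xB.
rewrite [RHS]indicE memNset//.
have [i iB] : exists i, ~ B i (Z i x).
  apply: contrapT => /forallNP h; apply: xB => i _.
  by apply: contrapT; exact: h.
by rewrite (bigD1 i)//= indicE memNset// mul0r.
Qed.

(** Independence on boxes is the case of indicator factors. The general case turns the exponential
    moment of a sum over the sample into an [n]-th power. *)
Lemma integral_prod_independent {d d'} {T : measurableType d}
    {S : measurableType d'} {R : realType} {n : nat} (Pr : probability T R)
    (P : probability S R) (Z : 'I_n -> T -> S)
    (mZ : forall i, measurable_fun setT (Z i))
    (ZP : forall i (B : set S), measurable B -> Pr (Z i @^-1` B) = P B)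
    (indep : forall B : 'I_n -> set S, (forall i, measurable (B i)) ->
      Pr (\bigcap_(i in [set: 'I_n]) (Z i @^-1` B i)) =
      (\prod_(i < n) Pr (Z i @^-1` B i))%E)
    (g : 'I_n -> S -> R) (c : 'I_n -> R) :
  (forall i, measurable_fun setT (g i)) -> (forall i s, 0 <= g i s) ->
  (forall i, (\int[P]_s (g i s)%:E = (c i)%:E)%E) ->
  (\int[Pr]_x (\prod_(i < n) g i (Z i x))%:E = (\prod_(i < n) c i)%:E)%E.
Proof.
(* Induction on the number [k] of factors that are not indicators. *)
suff H k (g' : 'I_n -> S -> R) (c' : 'I_n -> R) : (k <= n)%N ->
    (forall i, measurable_fun setT (g' i)) -> (forall i s, 0 <= g' i s) ->
    (forall i, (\int[P]_s (g' i s)%:E = (c' i)%:E)%E) ->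
    (forall i : 'I_n, (k <= i)%N ->
      exists2 B : set S, measurable B & g' i = (\1_B : S -> R)) ->
    (\int[Pr]_x (\prod_(i < n) g' i (Z i x))%:E = (\prod_(i < n) c' i)%:E)%E.
  move=> mg g0 gc; apply: (H n) => // i; by rewrite leqNgt ltn_ord.
elim: k g' c' => [|k IH] g' c' kn mg g0 gc g1.
  have {g1}/choice[B HB] i : exists B : set S,
      measurable B /\ g' i = (\1_B : S -> R).
    by have [B mB gB] := g1 i isT; exists B.
  have mB i : measurable (B i) by case: (HB i).
  have gB i : g' i = \1_(B i) by case: (HB i).
  under eq_integral do under eq_bigr do rewrite gB.
  under eq_integral do rewrite prod_indic_preimage.
  have mI : measurable (\bigcap_(i in [set: 'I_n]) (Z i @^-1` B i)).
    apply: fin_bigcap_measurable => //= i _.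
    by rewrite -[_ @^-1` _]setTI; exact: mZ.
  rewrite integral_indic// setIT.
  rewrite [LHS]indep//.
  rewrite -prodEFin; apply: eq_bigr => i _.
  by rewrite -gc ZP// gB integral_indic// setIT.
(* [k'] is the last factor still allowed to be arbitrary. The others form the weight [H1] under
   [Pr], to be compared with the constant weight [cc] under [P]. *)
pose k' := Ordinal kn.
pose H1 x := \prod_(i < n | i != k') g' i (Z i x).
have H10 x : 0 <= H1 x by apply: prodr_ge0.
have mH1 : measurable_fun setT H1.
  rewrite /H1; under eq_fun do rewrite big_mkcond.
  apply: (measurable_prod (h := fun i x =>
    if i != k' then g' i (Z i x) else 1)) => i _.
  by have [//|_] := eqVneq i k'; exact: measurableT_comp.
have c0 i : 0 <= c' i.
  by rewrite -lee_fin -gc integral_ge0// => s _; rewrite lee_fin.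
pose cc := \prod_(i < n | i != k') c' i.
have cc0 : 0 <= cc by apply: prodr_ge0.
have mgk := mg k'.
transitivity (\int[P]_s (cc * g' k' s)%:E)%E; last first.
  under eq_integral do rewrite EFinM.
  rewrite ge0_integralZl//; [|exact/measurable_EFinP|by move=> s _; rewrite lee_fin].
  by rewrite gc -EFinM mulrC (bigD1 k' (P := predT)).
transitivity (\int[Pr]_x (H1 x * g' k' (Z k' x))%:E)%E.
  by apply: eq_integral => x _; rewrite (bigD1 k')//= mulrC.
apply: (@ge0_integral_transport _ _ _ _ _ _ _ Pr P H1 (cst cc) (Z k') id) => //.
move=> B mB.
(* Testing the transport on a set [B] replaces factor [k'] by an indicator; this leaves one
   arbitrary factor fewer, so [IH] applies. *)
pose g2 i := if i == k' then \1_B else g' i.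
pose c2 i := if i == k' then fine (P B) else c' i.
transitivity (\int[Pr]_x (\prod_(i < n) g2 i (Z i x))%:E)%E.
  apply: eq_integral => x _; rewrite (bigD1 k')//= mulrC /g2 eqxx; congr (_ * _)%:E.
  by apply: eq_bigr => i /negbTE ->.
transitivity ((\prod_(i < n) c2 i)%:E)%E.
  apply: IH => //.
  - exact: ltnW.
  - by move=> i; rewrite /g2; case: ifP.
  - by move=> i s; rewrite /g2; case: ifP.
  - move=> i; rewrite /g2 /c2; case: ifP => // _.
    by rewrite integral_indic// setIT fineK// fin_num_measure.
  - move=> i ki; rewrite /g2; case: eqVneq => [_|ik]; first by exists B.
    apply: g1; rewrite ltn_neqAle ki andbT.
    by apply: contra_neq ik => ki'; apply: val_inj.
under [RHS]eq_integral do rewrite EFinM /=.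
rewrite ge0_integralZl//; last exact/measurable_EFinP.
rewrite integral_indic// setIT (bigD1 k')//= mulrC EFinM /c2 eqxx; congr (_ * _)%E.
  by congr EFin; apply: eq_bigr => i /negbTE ->.
by rewrite fineK// fin_num_measure.
Qed.

(** * Quadratic bound on the exponential *)

(** [(1 - z) ^+ 8] is the lower bound of [expR (- 8 * z)] that makes
    [expR_le_quadratic] polynomial. *)
Lemma quadratic_mul_exp8_ge1 {R : realType} (z : R) : `|z| <= 5 / 208 ->
  1 <= (1 + 8 * z + 13 / 20 * (8 * z) ^+ 2) * (1 - z) ^+ 8.
Proof.
rewrite ler_norml => /andP[zl zu].
have h0 : 0 <= 1 + 8 * z + 13 / 20 * (8 * z) ^+ 2 by nra.
have h4 : 0 <= z ^+ 2 * (28 - 8 * z + z ^+ 2) by rewrite mulr_ge0 ?sqr_ge0//; nra.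
have h5 : 0 <= z ^+ 2 * (7168 / 10 - 23296 / 10 * z).
  by apply: mulr_ge0; [exact: sqr_ge0|lra].
have h6 : 0 <= 56 / 10 - 1648 / 10 * z + z ^+ 2 * (7168 / 10 - 23296 / 10 * z).
  by apply: addr_ge0; [clear -zl zu; lra|exact: h5].
have h7 : 0 <= 70 - 56 * z + z ^+ 2 * (28 - 8 * z + z ^+ 2).
  by apply: addr_ge0; [clear -zl zu; lra|exact: h4].
(* The binomial expansion is cut after degree 3; the remainder is [z ^+ 4] times the nonnegative
   quantity of [h7]. *)
have h3 : 1 - 8 * z + 28 * z ^+ 2 - 56 * z ^+ 3 <= (1 - z) ^+ 8.
  rewrite -subr_ge0.
  have -> : (1 - z) ^+ 8 - (1 - 8 * z + 28 * z ^+ 2 - 56 * z ^+ 3) =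
    z ^+ 2 * z ^+ 2 * (70 - 56 * z + z ^+ 2 * (28 - 8 * z + z ^+ 2)) by ring.
  by apply: mulr_ge0 h7; apply: mulr_ge0; exact: sqr_ge0.
apply: le_trans (ler_wpM2l h0 h3).
rewrite -subr_ge0.
(* The constant and linear terms cancel. The coefficient of [z ^+ 2] is
   [28 - 64 + 64 * 13 / 20 = 56 / 10]; with [1 / 2] in place of [13 / 20] it would be negative. *)
have -> : (1 + 8 * z + 13 / 20 * (8 * z) ^+ 2) *
    (1 - 8 * z + 28 * z ^+ 2 - 56 * z ^+ 3) - 1 =
    z ^+ 2 * (56 / 10 - 1648 / 10 * z + z ^+ 2 * (7168 / 10 - 23296 / 10 * z)).
  by field.
by apply: mulr_ge0; [exact: sqr_ge0|exact: h6].
Qed.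

(** Inversion of [(1 - x / 8) ^+ 8 <= expR (- x)]. The radius is the size of the exponent in the
    application: an excess loss of at most [4 * M ^+ 2] times the parameter [5 / (104 * M ^+ 2)]. *)
Lemma expR_le_quadratic {R : realType} (x : R) : `|x| <= 5 / 26 ->
  expR x <= 1 + x + 13 / 20 * x ^+ 2.
Proof.
move=> x1.
pose z := x / 8.
have xz : x = 8 * z by rewrite /z; field.
have z1 : `|z| <= 5 / 208 by rewrite /z normrM (@ger0_norm _ 8^-1)//; lra.
have h1 : (1 - z) ^+ 8 <= expR (- x).
  have -> : - x = 8%:R * - z by rewrite xz mulrN.
  rewrite expRM_natl.
  apply: lerXn2r; rewrite ?nnegrE ?expR_ge0 ?expR_ge1Dx//.
  by move: z1; rewrite ler_norml => /andP[_ z1]; lra.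
have p0 : 0 <= 1 + x + 13 / 20 * x ^+ 2.
  by clear; nra.
have := le_trans (quadratic_mul_exp8_ge1 _ z1) (ler_wpM2l _ h1).
by rewrite -xz => /(_ p0); rewrite expRN ler_pdivlMr ?expR_gt0// mul1r.
Qed.

(** * Moment generating function and Chernoff bound *)

Lemma ae_bounded_integrable {d} {T : measurableType d} {R : realType}
    {P : probability T R} {f : T -> R} {M : R} :
  measurable_fun setT f -> {ae P, forall x, `|f x| <= M} ->
  P.-integrable setT (EFin \o f).
Proof.
move=> mf fM; apply/integrableP; split; first exact/measurable_EFinP.
apply: (@le_lt_trans _ _ (\int[P]_x (`|M|)%:E)%E).
  apply: ae_ge0_le_integral => //.
  - by apply: measurableT_comp => //; exact/measurable_EFinP.
  - move: fM; apply: filterS => x fM _ /=; rewrite lee_fin.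
    exact: le_trans (ler_norm _).
by rewrite integral_cst// [X in (_ * X)%E]probability_setT mule1 ltry.
Qed.

(** Integrate [expR_le_quadratic] at [- l * U] and conclude with [1 + u <= expR u]. The second
    moment is kept instead of [M ^+ 2], so that it can later be bounded by [V]. *)
Lemma mgf_le {d} {T : measurableType d} {R : realType} (P : probability T R)
    (U : T -> R) (M l : R) : measurable_fun setT U ->
  {ae P, forall x, `|U x| <= M} -> 0 <= l -> l * M <= 5 / 26 ->
  (\int[P]_x (expR (- (l * U x)))%:E <=
   (expR (- l * (\int[P]_x U x) + 13 / 20 * l ^+ 2 * (\int[P]_x (U x ^+ 2))))%:E)%E.
Proof.
move=> mU UM l0 lM.
have iU := ae_bounded_integrable mU UM.
have mU2 : measurable_fun setT (fun x => U x ^+ 2) by exact: measurable_funX.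
have iU2 : P.-integrable setT (EFin \o (fun x => U x ^+ 2)).
  apply: (@ae_bounded_integrable _ _ _ _ _ (M ^+ 2)) => //.
  move: UM; apply: filterS => x UM; rewrite normrX.
  by apply: lerXn2r => //; rewrite nnegrE// (le_trans _ UM).
have i1 : P.-integrable setT (EFin \o (fun=> 1 : R)).
  exact: finite_measure_integrable_cst.
have iZU : P.-integrable setT (EFin \o (fun x => - l * U x)).
  exact: (integrableZl measurableT _ iU).
have iZU2 : P.-integrable setT (EFin \o (fun x => 13 / 20 * l ^+ 2 * U x ^+ 2)).
  exact: (integrableZl measurableT _ iU2).
have iD : P.-integrable setT
    (EFin \o (fun x => - l * U x + 13 / 20 * l ^+ 2 * U x ^+ 2)).
  exact: (integrableD measurableT iZU iZU2).
have iQ : P.-integrable setT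
    (EFin \o (fun x => 1 + (- l * U x + 13 / 20 * l ^+ 2 * U x ^+ 2))).
  exact: (integrableD measurableT i1 iD).
apply: (@le_trans _ _
  (\int[P]_x (1 + (- l * U x + 13 / 20 * l ^+ 2 * U x ^+ 2))%:E)%E).
  apply: ae_ge0_le_integral => //.
  - apply/measurable_EFinP; apply: measurableT_comp => //.
    by apply: measurableT_comp => //; exact: measurable_funM.
  (* The quadratic [1 + u + 13 / 20 * u ^+ 2] has negative discriminant. *)
  - by move=> x _; rewrite lee_fin; nra.
  - exact: measurable_int iQ.
  - move: UM; apply: filterS => x UM _; rewrite lee_fin.
    have := @expR_le_quadratic R (- l * U x).
    rewrite -mulNr addrA exprMn sqrrN mulrA.
    apply; rewrite normrM normrN (ger0_norm l0).
    by apply: le_trans lM; rewrite ler_wpM2l.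
rewrite -[X in (X <= _)%E]fineK; last exact: integrable_fin_num.
rewrite lee_fin -/(Rintegral _ _ _) RintegralD// RintegralD//.
rewrite RintegralZl// RintegralZl//.
rewrite Rintegral_cst// [X in fine X]probability_setT mulr1.
exact: expR_ge1Dx.
Qed.

Lemma measurable_le_cst {d} {T : measurableType d} {R : realType}
    (W : T -> R) (t : R) : measurable_fun setT W -> measurable [set x | t <= W x].
Proof.
move=> mW; have := measurable_fun_le measurableT (measurable_cst t) mW.
by rewrite setTI.
Qed.

Lemma markov_expR {d} {T : measurableType d} {R : realType} (P : probability T R)
    (W : T -> R) (t : R) : measurable_fun setT W ->
  (P [set x | t <= W x]%R <= (expR (- t))%:E * \int[P]_x (expR (W x))%:E)%E.
Proof.
move=> mW.
have mA := measurable_le_cst W t mW.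
have -> : P [set x | t <= W x] = (\int[P]_x (\1_[set x | t <= W x] x)%:E)%E.
  by rewrite integral_indic// setIT.
have me : measurable_fun setT (EFin \o (fun x => expR (W x))).
  by apply/measurable_EFinP; exact: measurableT_comp.
rewrite -ge0_integralZl//.
apply: ge0_le_integral => //.
- by apply/measurable_EFinP.
- by apply: measurable_funeM.
- move=> x _; rewrite -EFinM lee_fin indicE; case: (boolP (x \in _)) => [|_].
    by rewrite inE /= => tW; rewrite -expRD -[leLHS]expR0 ler_expR; lra.
  by rewrite mulr_ge0 ?expR_ge0.
Qed.

(** Markov's inequality for the exponential of [- l] times the sum, whose mean is the [n]-th power
    of a one-sample value [c <= expR psi]. The threshold [n * psi + ln K] makes the [psi] terms
    cancel and leaves [K^-1], ready for a union bound. *)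
Lemma bernstein_iid {d d'} {T : measurableType d}
    {S : measurableType d'} {R : realType} {n : nat} (Pr : probability T R)
    (P : probability S R) (Z : 'I_n -> T -> S)
    (mZ : forall i, measurable_fun setT (Z i))
    (ZP : forall i (B : set S), measurable B -> Pr (Z i @^-1` B) = P B)
    (indep : forall B : 'I_n -> set S, (forall i, measurable (B i)) ->
      Pr (\bigcap_(i in [set: 'I_n]) (Z i @^-1` B i)) =
      (\prod_(i < n) Pr (Z i @^-1` B i))%E)
    (U : S -> R) (M l K : R) : measurable_fun setT U ->
  {ae P, forall x, `|U x| <= M} -> 0 <= l -> l * M <= 5 / 26 -> 0 < K ->
  (Pr [set w | n%:R * (- l * (\int[P]_x U x) +
      13 / 20 * l ^+ 2 * (\int[P]_x (U x ^+ 2))) + ln K <=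
      - l * \sum_(i < n) U (Z i w)]%R <= (K^-1)%:E)%E.
Proof.
move=> mU UM l0 lM K0.
set psi := - l * _ + _.
have mgf := mgf_le P U M l mU UM l0 lM; rewrite -/psi in mgf.
have mg : measurable_fun setT (fun x => expR (- (l * U x))).
  apply: measurableT_comp => //.
  by apply: measurableT_comp => //; exact: measurable_funM.
(* The product formula asks for a real exponential moment; [mgf] supplies its finiteness. *)
have [c cE /andP[c0 c1]] : exists2 c : R,
    (\int[P]_x (expR (- (l * U x)))%:E = c%:E)%E & 0 <= c <= expR psi.
  have i0 : (0 <= \int[P]_x (expR (- (l * U x)))%:E)%E.
    by apply: integral_ge0 => x _; rewrite lee_fin expR_ge0.
  have fin : (\int[P]_x (expR (- (l * U x)))%:E)%E \is a fin_num.
    by rewrite ge0_fin_numE// (le_lt_trans mgf)// ltry.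
  exists (fine (\int[P]_x (expR (- (l * U x)))%:E)); first by rewrite fineK.
  by rewrite fine_ge0//= -lee_fin fineK.
have mW : measurable_fun setT (fun w => - l * \sum_(i < n) U (Z i w)).
  apply: measurable_funM => //.
  by apply: measurable_sum => i; exact: measurableT_comp.
apply: le_trans (markov_expR _ _ _ mW) _.
have -> : (\int[Pr]_w (expR (- l * \sum_(i < n) U (Z i w)))%:E = (c ^+ n)%:E)%E.
  have := integral_prod_independent Pr P Z mZ ZP indep
    (fun _ x => expR (- (l * U x))) (fun=> c) (fun=> mg)
    (fun _ _ => expR_ge0 _) (fun=> cE).
  rewrite prodr_const card_ord => <-; apply: eq_integral => w _.
  congr EFin; rewrite mulr_sumr expR_sum; apply: eq_bigr => i _.
  by rewrite mulNr.
rewrite -EFinM lee_fin opprD expRD (expRN (ln K)) lnK ?posrE//.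
rewrite mulrAC ger_pMl ?invr_gt0//.
rewrite expRN mulrC -ler_pdivlMr ?invr_gt0 ?expR_gt0// mul1r invrK.
rewrite expRM_natl; apply: lerXn2r => //; rewrite nnegrE//; exact: expR_ge0.
Qed.

(** * Conditional expectation and moments of the excess loss *)

(** Adding [M] turns the signed [k] into a nonnegative weight, to which
    [integral_transport] applies. *)
Lemma integral_shift_mul {d} {T : measurableType d} {R : realType}
    (P : probability T R) (k w : T -> R) (M C : R) :
  measurable_fun setT k -> measurable_fun setT w ->
  {ae P, forall z, `|k z| <= M} -> {ae P, forall z, `|w z| <= C} ->
  (\int[P]_z (Num.max (k z + M) 0 * w z)%:E =
   \int[P]_z (k z * w z)%:E + \int[P]_z (M * w z)%:E)%E.
Proof.
move=> mk mw kM wC.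
have mkw : measurable_fun setT (fun z => k z * w z) by exact: measurable_funM.
have mMw : measurable_fun setT (fun z => M * w z) by exact: measurable_funM.
have ikw : P.-integrable setT (EFin \o (fun z => k z * w z)).
  apply: (@ae_bounded_integrable _ _ _ _ _ (M * C)) => //.
  by apply: filterS2 kM wC => z kM wC; rewrite normrM ler_pM.
have iMw : P.-integrable setT (EFin \o (fun z => M * w z)).
  apply: (@ae_bounded_integrable _ _ _ _ _ (`|M| * C)) => //.
  by move: wC; apply: filterS => z wC; rewrite normrM ler_wpM2l.
rewrite -integralD_EFin//; apply: ae_eq_integral => //.
- apply/measurable_EFinP; apply: measurable_funM => //.
  by apply: measurable_maxr => //; exact: measurable_funD.
- by apply/measurable_EFinP; exact: measurable_funD.
- move: kM; apply: filterS => z; rewrite ler_norml => /andP[kM _] _.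
  by rewrite max_l ?mulrDl// -lerBlDr sub0r.
Qed.

(** The defining identity of the conditional expectation is the case of indicators [h]. Transport
    along [fst], with the shifted weights [y + M] and [fs + M], extends it to bounded [h]. *)
Lemma cond_exp_mul {d} {X : measurableType d} {R : realType}
    (P : probability (X * R)%type R) (fs h : X -> R) (M C : R) :
  measurable_fun setT fs -> measurable_fun setT h ->
  (forall A : set X, measurable A ->
    (\int[P]_(z in A `*` setT) (z.2)%:E =
     \int[P]_(z in A `*` setT) (fs z.1)%:E)%E) ->
  {ae P, forall z, `|z.2| <= M} -> {ae P, forall z, `|fs z.1| <= M} ->
  {ae P, forall z, `|h z.1| <= C} ->
  \int[P]_z (z.2 * h z.1) = \int[P]_z (fs z.1 * h z.1).
Proof.
move=> mfs mh Hce yM fsM hC.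
have m1 : measurable_fun setT (fst : X * R -> X) by exact: measurable_fst.
have m2 : measurable_fun setT (snd : X * R -> R) by exact: measurable_snd.
have mfs1 : measurable_fun setT (fun z : X * R => fs z.1).
  exact: measurableT_comp.
have mh1 : measurable_fun setT (fun z : X * R => h z.1).
  exact: measurableT_comp.
have mpos (k : X * R -> R) : measurable_fun setT k ->
    measurable_fun setT (fun z => Num.max (k z + M) 0).
  by move=> mk; apply: measurable_maxr => //; exact: measurable_funD.
have posmax (k : X * R -> R) z : 0 <= Num.max (k z + M) 0.
  by rewrite le_max lexx orbT.
have key : (\int[P]_z (Num.max (z.2 + M) 0 * h z.1)%:E =
            \int[P]_z (Num.max (fs z.1 + M) 0 * h z.1)%:E)%E.
  apply: (@integral_transport _ _ _ _ _ _ _ P P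
    (fun z => Num.max (z.2 + M) 0) (fun z => Num.max (fs z.1 + M) 0) fst fst) => //.
  - exact: mpos.
  - exact: mpos.
  - by move=> z; exact: (posmax (fs \o fst)).
  - move=> A mA.
    have mA1 : measurable_fun setT (fun z : X * R => \1_A z.1 : R).
      by apply: measurableT_comp m1.
    have A1 : {ae P, forall z, `|\1_A z.1 : R| <= 1}.
      by apply: aeW => z; rewrite indicE normr_nat; case: (_ \in _).
    rewrite (integral_shift_mul _ _ _ _ _ m2 mA1 yM A1).
    rewrite (integral_shift_mul _ _ _ _ _ mfs1 mA1 fsM A1).
    congr (_ + _)%E.
    have := Hce A mA; rewrite integral_mkcond [X in _ = X -> _]integral_mkcond.
    have E (k : X * R -> R) :
        (\int[P]_x ((fun z => (k z)%:E) \_ (A `*` setT)) x =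
         \int[P]_z (k z * \1_A z.1)%:E)%E.
      apply: eq_integral => z _; rewrite patchE indicE in_setX in_setT andbT.
      by case: ifP; rewrite ?mulr1 ?mulr0.
    by rewrite !E.
have iprod (k : X * R -> R) : measurable_fun setT k ->
    {ae P, forall z, `|k z| <= M} ->
    P.-integrable setT (EFin \o (fun z => k z * h z.1)).
  move=> mk kM.
  apply: (@ae_bounded_integrable _ _ _ _ _ (M * C)); first exact: measurable_funM.
  by apply: filterS2 kM hC => z kM hC; rewrite normrM ler_pM.
(* Finiteness lets the term created by the shift be cancelled from both sides of [key]. *)
have fM : (\int[P]_z (M * h z.1)%:E)%E \is a fin_num.
  apply: integrable_fin_num => //.
  apply: (@ae_bounded_integrable _ _ _ _ _ (`|M| * C)).
    exact: measurable_funM.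
  by move: hC; apply: filterS => z hC; rewrite normrM ler_wpM2l.
move: key; rewrite (integral_shift_mul _ _ _ _ _ m2 mh1 yM hC).
rewrite (integral_shift_mul _ _ _ _ _ mfs1 mh1 fsM hC).
by move=> /(congr1 (fun u => u - \int[P]_z (M * h z.1)%:E)%E); rewrite !addeK// => h1;
  rewrite /Rintegral h1.
Qed.

(** The mean comes from [U = (f - g)^2 + 2 (f - g)(g - fs) + 2 (f - g)(fs - y)], whose last term has
    mean zero; the third identity expands the square of [(f - g) + (g - fs)]. *)
Lemma excess_loss_moments {d} {X : measurableType d} {R : realType}
    (P : probability (X * R)%type R) (f g fs : X -> R) (M : R) :
  measurable_fun setT f -> measurable_fun setT g -> measurable_fun setT fs ->
  (forall A : set X, measurable A ->
    (\int[P]_(z in A `*` setT) (z.2)%:E =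
     \int[P]_(z in A `*` setT) (fs z.1)%:E)%E) ->
  {ae P, forall z, [/\ `|f z.1| <= M, `|g z.1| <= M, `|fs z.1| <= M & `|z.2| <= M]} ->
  let V := \int[P]_z ((f z.1 - g z.1) ^+ 2) in
  let A := \int[P]_z ((f z.1 - g z.1) * (g z.1 - fs z.1)) in
  let U z := (f z.1 - z.2) ^+ 2 - (g z.1 - z.2) ^+ 2 in
  [/\ \int[P]_z U z = V + 2 * A,
      \int[P]_z (U z ^+ 2) <= 16 * M ^+ 2 * V &
      \int[P]_z ((f z.1 - fs z.1) ^+ 2) =
        V + 2 * A + \int[P]_z ((g z.1 - fs z.1) ^+ 2)].
Proof.
move=> mf mg mfs Hce bnd V A U.
have m1 : measurable_fun setT (fst : X * R -> X) by exact: measurable_fst.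
have m2 : measurable_fun setT (snd : X * R -> R) by exact: measurable_snd.
have mf1 : measurable_fun setT (fun z : X * R => f z.1) by exact: measurableT_comp.
have mg1 : measurable_fun setT (fun z : X * R => g z.1) by exact: measurableT_comp.
have mfs1 : measurable_fun setT (fun z : X * R => fs z.1) by exact: measurableT_comp.
(* The bound [4 * M] is the one that [f + g - 2 y] requires; it is used for all factors alike. *)
have int2 (k1 k2 : X * R -> R) :
    measurable_fun setT k1 -> measurable_fun setT k2 ->
    {ae P, forall z, `|k1 z| <= 4 * M} -> {ae P, forall z, `|k2 z| <= 4 * M} ->
    P.-integrable setT (EFin \o (fun z => k1 z * k2 z)).
  move=> mk1 mk2 k1M k2M.
  apply: (@ae_bounded_integrable _ _ _ _ _ (4 * M * (4 * M))).
    exact: measurable_funM.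
  by apply: filterS2 k1M k2M => z k1M k2M; rewrite normrM ler_pM.
have mfg : measurable_fun setT (fun z : X * R => f z.1 - g z.1).
  exact: measurable_funB.
have mgs : measurable_fun setT (fun z : X * R => g z.1 - fs z.1).
  exact: measurable_funB.
have msy : measurable_fun setT (fun z : X * R => fs z.1 - z.2).
  exact: measurable_funB.
have mS : measurable_fun setT (fun z : X * R => f z.1 + g z.1 - 2 * z.2).
  by apply: measurable_funB; [exact: measurable_funD|exact: measurable_funM].
have bfg : {ae P, forall z, `|f z.1 - g z.1| <= 4 * M}.
  move: bnd; apply: filterS => z []; rewrite !ler_norml.
  by move=> /andP[? ?] /andP[? ?] /andP[? ?] /andP[? ?]; apply/andP; split; lra.
have bgs : {ae P, forall z, `|g z.1 - fs z.1| <= 4 * M}.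
  move: bnd; apply: filterS => z []; rewrite !ler_norml.
  by move=> /andP[? ?] /andP[? ?] /andP[? ?] /andP[? ?]; apply/andP; split; lra.
have bsy : {ae P, forall z, `|fs z.1 - z.2| <= 4 * M}.
  move: bnd; apply: filterS => z []; rewrite !ler_norml.
  by move=> /andP[? ?] /andP[? ?] /andP[? ?] /andP[? ?]; apply/andP; split; lra.
have bS : {ae P, forall z, `|f z.1 + g z.1 - 2 * z.2| <= 4 * M}.
  move: bnd; apply: filterS => z []; rewrite !ler_norml.
  by move=> /andP[? ?] /andP[? ?] /andP[? ?] /andP[? ?]; apply/andP; split; lra.
have iV : P.-integrable setT (EFin \o (fun z => (f z.1 - g z.1) ^+ 2)).
  exact: int2.
have iA : P.-integrable setT
    (EFin \o (fun z => (f z.1 - g z.1) * (g z.1 - fs z.1))) by exact: int2.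
have iG : P.-integrable setT (EFin \o (fun z => (g z.1 - fs z.1) ^+ 2)).
  exact: int2.
have iY : P.-integrable setT
    (EFin \o (fun z => (f z.1 - g z.1) * (fs z.1 - z.2))) by exact: int2.
have i2 (k : X * R -> R) : P.-integrable setT (EFin \o k) ->
    P.-integrable setT (EFin \o (fun z => 2 * k z)).
  by move=> ik; exact: (integrableZl measurableT 2 ik).
have iVA : P.-integrable setT (EFin \o (fun z => (f z.1 - g z.1) ^+ 2 +
    2 * ((f z.1 - g z.1) * (g z.1 - fs z.1)))).
  exact: (integrableD measurableT iV (i2 _ iA)).
(* The noise is orthogonal to bounded functions of the design, here [f - g]. *)
have Y0 : \int[P]_z ((f z.1 - g z.1) * (fs z.1 - z.2)) = 0.
  have is' : P.-integrable setT (EFin \o (fun z => fs z.1 * (f z.1 - g z.1))).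
    apply: int2 => //.
    move: bnd; apply: filterS => z []; rewrite !ler_norml.
    by move=> /andP[? ?] /andP[? ?] /andP[? ?] /andP[? ?]; apply/andP; split; lra.
  have iy' : P.-integrable setT (EFin \o (fun z => z.2 * (f z.1 - g z.1))).
    apply: int2 => //.
    move: bnd; apply: filterS => z []; rewrite !ler_norml.
    by move=> /andP[? ?] /andP[? ?] /andP[? ?] /andP[? ?]; apply/andP; split; lra.
  have -> : \int[P]_z ((f z.1 - g z.1) * (fs z.1 - z.2)) =
    \int[P]_z (fs z.1 * (f z.1 - g z.1) - z.2 * (f z.1 - g z.1)).
    by apply: eq_Rintegral => z _; ring.
  rewrite RintegralB//; apply/eqP; rewrite subr_eq0 eq_sym; apply/eqP.
  apply: (cond_exp_mul P fs (fun x => f x - g x) M (4 * M)) => //.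
  - exact: measurable_funB.
  - by move: bnd; apply: filterS => z [].
  - by move: bnd; apply: filterS => z [].
split.
- transitivity (\int[P]_z ((f z.1 - g z.1) ^+ 2 +
    2 * ((f z.1 - g z.1) * (g z.1 - fs z.1)) +
    2 * ((f z.1 - g z.1) * (fs z.1 - z.2)))).
    by apply: eq_Rintegral => z _; rewrite /U; ring.
  rewrite RintegralD//; last exact: i2.
  rewrite RintegralD//; last exact: i2.
  by rewrite !RintegralZl// Y0 mulr0 addr0.
- have mfgS : measurable_fun setT
      (fun z : X * R => (f z.1 - g z.1) * (f z.1 + g z.1 - 2 * z.2)).
    exact: measurable_funM.
  have UE z : U z = (f z.1 - g z.1) * (f z.1 + g z.1 - 2 * z.2).
    by rewrite /U; ring.
  have mU2 : measurable_fun setT (fun z => U z ^+ 2).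
    by under eq_fun do rewrite UE; exact: measurable_funX.
  have iU2 : P.-integrable setT (EFin \o (fun z => U z ^+ 2)).
    apply: (@ae_bounded_integrable _ _ _ _ _ ((4 * M * (4 * M)) ^+ 2)) => //.
    apply: filterS2 bfg bS => z b1 b2; rewrite UE normrX normrM.
    have M0 := le_trans (normr_ge0 _) b1.
    apply: lerXn2r; rewrite ?nnegrE; [exact: mulr_ge0|exact: mulr_ge0|].
    exact: ler_pM.
  have iV16 : P.-integrable setT
      (EFin \o (fun z => 16 * M ^+ 2 * (f z.1 - g z.1) ^+ 2)).
    exact: (integrableZl measurableT (16 * M ^+ 2) iV).
  rewrite -RintegralZl//; apply: fine_le; [exact: integrable_fin_num..|].
  apply: ae_ge0_le_integral => //.
  + by move=> z _; rewrite lee_fin sqr_ge0.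
  + exact/measurable_EFinP.
  + by move=> z _; rewrite lee_fin; apply: mulr_ge0; [apply: mulr_ge0|];
      rewrite ?sqr_ge0 ?ler0n.
  + exact: measurable_int iV16.
  + move: bS; apply: filterS => z b2 _; rewrite lee_fin UE exprMn mulrC.
    rewrite ler_wpM2r ?sqr_ge0// -real_normK ?num_real//.
    have -> : 16 * M ^+ 2 = (4 * M) ^+ 2 by ring.
    by apply: lerXn2r; rewrite ?nnegrE// (le_trans _ b2).
- transitivity (\int[P]_z ((f z.1 - g z.1) ^+ 2 +
    2 * ((f z.1 - g z.1) * (g z.1 - fs z.1)) + (g z.1 - fs z.1) ^+ 2)).
    by apply: eq_Rintegral => z _; ring.
  rewrite RintegralD// RintegralD//; last exact: i2.
  by rewrite RintegralZl//.
Qed.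

(** * Union bound, training marginal and deviation of the empirical risk minimizer *)

Lemma measure_bigsetU_le {d} {T : measurableType d} {R : realType}
    (mu : {measure set T -> \bar R}) (I : Type) (r : seq I) (F : I -> set T) :
  (forall i, measurable (F i)) ->
  (mu (\big[setU/set0]_(i <- r) F i) <= \sum_(i <- r) mu (F i))%E.
Proof.
move=> mF; elim: r => [|i r IH]; first by rewrite !big_nil measure0.
rewrite !big_cons; apply: (le_trans (measureU2 _ _ _)) => //.
  exact: bigsetU_measurable.
by rewrite leeD2l.
Qed.

(** Transport along [fst], with weight 1 under [P] and the density [p] extended by zero under
    [mu]. *)
Lemma marginal_integral {d} {X : measurableType d} {R : realType}
    (mu : {measure set X -> \bar R}) (P : probability (X * R)%type R)
    (Xi : set X) (p g : X -> R) :
  measurable Xi -> measurable_fun Xi p -> (forall x, Xi x -> 0 <= p x) ->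
  (forall A : set X, measurable A ->
    P (A `*` setT) = (\int[mu]_(x in A `&` Xi) (p x)%:E)%E) ->
  measurable_fun setT g ->
  (\int[P]_z (g z.1)%:E = \int[mu]_(x in Xi) (g x * p x)%:E)%E.
Proof.
move=> mXi mp p0 HP mg.
transitivity (\int[P]_z (1 * g z.1)%:E)%E.
  by apply: eq_integral => z _; rewrite mul1r.
transitivity (\int[mu]_x ((p \_ Xi) x * g x)%:E)%E; last first.
  rewrite [RHS]integral_mkcond; apply: eq_integral => x _.
  by rewrite !patchE; case: ifP; rewrite ?mul0r// mulrC.
have m1 : measurable_fun setT (fst : X * R -> X) by exact: measurable_fst.
apply: (@integral_transport _ _ _ _ _ _ _ P mu (cst 1) (p \_ Xi) fst id) => //.
- by apply/(measurable_restrictT _ mXi).1.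
- by move=> x; rewrite patchE; case: ifP => //; rewrite inE => /p0.
move=> B mB.
transitivity (P (B `*` setT)).
  rewrite -[B `*` _]setIT -integral_indic//; last exact: measurableX.
  by apply: eq_integral => z _; rewrite mul1r !indicE in_setX in_setT andbT.
rewrite HP// setIC integral_mkcondr integral_mkcond; apply: eq_integral => x _.
rewrite !patchE indicE.
by case: (x \in Xi); case: (x \in B); rewrite /= ?mulr1 ?mulr0 ?mul0r.
Qed.

(** [S] stands for the empirical sum of the excess loss, nonpositive at a minimizer; the last
    hypothesis is the complement of the Chernoff event with [L = ln K]. Dropping [S] leaves
    [n * l * (V / 2 + 2 * A) < L], and [2 / l = 208 / 5 * y ^+ 2]. *)
Lemma erm_deviation {R : realType} (n : nat) (V A EU EU2 S L y l : R) :
  (0 < n)%N -> 0 < y -> l = 5 / (104 * y ^+ 2) ->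
  EU = V + 2 * A -> EU2 <= 16 * y ^+ 2 * V -> S <= 0 ->
  - l * S < n%:R * (- l * EU + 13 / 20 * l ^+ 2 * EU2) + L ->
  V + 4 * A < 208 / 5 * (y ^+ 2 * L / n%:R).
Proof.
move=> n0 y0 lE EUE hEU2 S0 H.
have n0' : 0 < n%:R :> R by rewrite ltr0n.
have y2 : 0 < y ^+ 2 by rewrite exprn_gt0.
have l0 : 0 < l by rewrite lE divr_gt0// mulr_gt0.
have ly : l * y ^+ 2 = 5 / 104 by rewrite lE; field; rewrite gt_eqF.
(* [l] is chosen so that the second-order term costs exactly half of [V]. *)
have h1 : 13 / 20 * l ^+ 2 * EU2 <= l * (V / 2).
  apply: (@le_trans _ _ (13 / 20 * l ^+ 2 * (16 * y ^+ 2 * V))).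
    by apply: ler_wpM2l => //; rewrite mulr_ge0// ?sqr_ge0.
  have -> : 13 / 20 * l ^+ 2 * (16 * y ^+ 2 * V) =
    (13 * 4 / 5) * (l * y ^+ 2) * (l * V) by field.
  rewrite ly; have -> : (13 * 4 / 5) * (5 / 104) * (l * V) = l * (V / 2) by field.
  by [].
have h2 : 0 <= - l * S by rewrite mulNr oppr_ge0 mulr_ge0_le0// ltW.
have h3 : n%:R * (l * (V / 2 + 2 * A)) < L.
  have : n%:R * (- l * EU + 13 / 20 * l ^+ 2 * EU2) <=
      - (n%:R * (l * (V / 2 + 2 * A))).
    rewrite -mulrN ler_pM2l// EUE.
    have -> : - l * (V + 2 * A) = - (l * (V / 2 + 2 * A)) - l * (V / 2) by field.
    by clear -h1; lra.
  by clear -h2 H; lra.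
have -> : 208 / 5 * (y ^+ 2 * L / n%:R) = L * (2 / (n%:R * l)).
  rewrite lE; field; rewrite !gt_eqF//=.
have -> : V + 4 * A = n%:R * (l * (V / 2 + 2 * A)) * (2 / (n%:R * l)).
  by field; rewrite !gt_eqF.
by rewrite ltr_pM2r// divr_gt0// mulr_gt0.
Qed.

Lemma sqrt3_le2 {R : rcfType} : Num.sqrt (3 : R) <= 2.
Proof.
have -> : (2 : R) = Num.sqrt (2 ^+ 2) by rewrite sqrtr_sqr ger0_norm.
by rewrite ler_sqrt; lra.
Qed.

(** One event serves all indices, so [j] may afterwards depend on the sample. Each index fails with
    probability at most [delta / #|I|], and the failures add up to [delta]. *)
Lemma sample_risk_bound {d d'} {X : measurableType d} {T : measurableType d'}
    {R : realType} {n : nat} (n0 : (0 < n)%N) (Pr : probability T R)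
    (P : probability (X * R)%type R) (Z : 'I_n -> T -> X * R)
    (mZ : forall i, measurable_fun setT (Z i))
    (ZP : forall i (B : set (X * R)), measurable B -> Pr (Z i @^-1` B) = P B)
    (indep : forall B : 'I_n -> set (X * R), (forall i, measurable (B i)) ->
      Pr (\bigcap_(i in [set: 'I_n]) (Z i @^-1` B i)) =
      (\prod_(i < n) Pr (Z i @^-1` B i))%E)
    (I : finType) (fam : I -> X -> R) (b : I) (fs : X -> R) (M delta : R) :
  0 < M -> 0 < delta ->
  (forall j, measurable_fun setT (fam j)) -> measurable_fun setT fs ->
  (forall A : set X, measurable A ->
    (\int[P]_(z in A `*` setT) (z.2)%:E =
     \int[P]_(z in A `*` setT) (fs z.1)%:E)%E) ->
  (forall j, {ae P, forall z, `|fam j z.1| <= M}) ->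
  {ae P, forall z, `|fs z.1| <= M} -> {ae P, forall z, `|z.2| <= M} ->
  exists E : set T, [/\ measurable E, ((1 - delta)%:E <= Pr E)%E &
    forall w j, E w ->
      \sum_(i < n) (fam j (Z i w).1 - (Z i w).2) ^+ 2 <=
      \sum_(i < n) (fam b (Z i w).1 - (Z i w).2) ^+ 2 ->
      \int[P]_z ((fam j z.1 - fam b z.1) ^+ 2) +
      4 * \int[P]_z ((fam j z.1 - fam b z.1) * (fam b z.1 - fs z.1)) <
      208 / 5 * (M ^+ 2 * ln (#|I|%:R / delta) / n%:R)].
Proof.
move=> M0 delta0 mfam mfs Hce famM fsM yM.
pose U j (z : X * R) := (fam j z.1 - z.2) ^+ 2 - (fam b z.1 - z.2) ^+ 2.
pose l := 5 / (104 * M ^+ 2).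
pose K := #|I|%:R / delta.
have I0 : 0 < #|I|%:R :> R by rewrite ltr0n; apply/card_gt0P; exists b.
have K0 : 0 < K by rewrite divr_gt0.
have M2 : 0 < M ^+ 2 by rewrite exprn_gt0.
have l0 : 0 <= l by rewrite divr_ge0// mulr_ge0// ltW.
have m1 : measurable_fun setT (fst : X * R -> X) by exact: measurable_fst.
have m2 : measurable_fun setT (snd : X * R -> R) by exact: measurable_snd.
have mU j : measurable_fun setT (U j).
  by apply: measurable_funB; apply: measurable_funX; apply: measurable_funB => //;
    exact: measurableT_comp.
have bnd j : {ae P, forall z,
    [/\ `|fam j z.1| <= M, `|fam b z.1| <= M, `|fs z.1| <= M & `|z.2| <= M]}.
  apply: filterS2 (filterI (famM j) (famM b)) (filterI fsM yM) => z.
  by move=> [? ?] [? ?]; split.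
(* Both squares lie between 0 and [4 * M ^+ 2], hence so does the absolute value of their
   difference. *)
have bU j : {ae P, forall z, `|U j z| <= 4 * M ^+ 2}.
  move: (bnd j); apply: filterS => z [].
  rewrite /U !ler_norml => /andP[? ?] /andP[? ?] _ /andP[? ?].
  have sq (u : R) : - M <= u <= M -> 0 <= (u - z.2) ^+ 2 <= 4 * M ^+ 2.
    move=> /andP[? ?]; rewrite sqr_ge0/=; nra.
  have /andP[? ?] := sq (fam j z.1) ltac:(apply/andP; split; lra).
  have /andP[? ?] := sq (fam b z.1) ltac:(apply/andP; split; lra).
  by apply/andP; split; lra.
have lM : l * (4 * M ^+ 2) <= 5 / 26.
  have -> : l * (4 * M ^+ 2) = 5 / 26 by rewrite /l; field; rewrite gt_eqF.
  by [].
pose t j := n%:R * (- l * (\int[P]_z U j z) +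
      13 / 20 * l ^+ 2 * (\int[P]_z (U j z ^+ 2))) + ln K.
(* The inequality is non-strict, so that the complement yields a strict one. *)
pose bad j := [set w | t j <= - l * \sum_(i < n) U j (Z i w)].
have mbad j : measurable (bad j).
  apply: measurable_le_cst; apply: measurable_funM => //.
  by apply: measurable_sum => i; exact: measurableT_comp.
have Pbad j : (Pr (bad j) <= (K^-1)%:E)%E.
  exact: (bernstein_iid Pr P Z mZ ZP indep (U j) _ l K (mU j) (bU j) l0 lM K0).
pose B := \big[setU/set0]_(j <- enum I) bad j.
have mB : measurable B by exact: bigsetU_measurable.
have PB : (Pr B <= delta%:E)%E.
  apply: (le_trans (measure_bigsetU_le Pr I (enum I) bad mbad)).
  apply: (@le_trans _ _ (\sum_(j <- enum I) (K^-1)%:E)%E).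
    by apply: lee_sum => j _; exact: Pbad.
  rewrite sumEFin lee_fin big_enum/= sumr_const -mulr_natl /K invf_div.
  by rewrite mulrCA divff ?gt_eqF// mulr1.
exists (~` B); split; first exact: measurableC.
  rewrite [leRHS]probability_setC// EFinB leeB//.
move=> w j nB erm.
have [EU EU2 _] := excess_loss_moments P (fam j) (fam b) fs M
  (mfam j) (mfam b) mfs Hce (bnd j).
apply: (erm_deviation n _ _ _ _ (\sum_(i < n) U j (Z i w)) _ _ l n0 M0 erefl EU EU2).
  by rewrite sumrB subr_le0.
rewrite ltNge; apply/negP => Bj; apply: nB.
rewrite /B -bigcup_seq; exists j => //=.
by rewrite mem_enum.
Qed.

(** * Change of measure from the training risk to the test risk *)

Theorem theorem1 (R : realType) (d : nat)
  (mu : {measure set (d.-tuple R) -> \bar R})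
  (Hmu : is_lebesgue_tuple mu)
  (Xi : set (d.-tuple R)) (mXi : measurable Xi)
  (dtrain dtest : d.-tuple R -> R)
  (Htrain : density_on mu Xi dtrain) (Htest : density_on mu Xi dtest)
  (Htrain_pos : forall x, Xi x -> 0 < dtrain x)
  (P : probability (d.-tuple R * R)%type R)
  (HPmarg : forall A : set (d.-tuple R), measurable A ->
     P (A `*` setT) = (\int[mu]_(x in A `&` Xi) (dtrain x)%:E)%E)
  (fstar : d.-tuple R -> R) (Hfstar : cond_exp_version P fstar)
  (I : finType) (fam : I -> d.-tuple R -> R) (fam_inj : injective fam)
  (fam_meas : forall j, measurable_fun setT (fam j))
  (yinf : R) (yinf_gt0 : 0 < yinf)
  (HFbd : forall j x, Xi x -> `|fam j x| <= yinf)
  (Hfstarbd : forall x, Xi x -> `|fstar x| <= yinf)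
  (Hybd : {ae P, forall z, `|z.2| <= yinf})
  (fbar : I)
  (Hfbar : forall j, (Rtest mu Xi dtest fstar (fam fbar)
                      <= Rtest mu Xi dtest fstar (fam j))%E)
  (n : nat) (n_gt0 : (0 < n)%N)
  (dO : measure_display) (O : measurableType dO) (Pr : probability O R)
  (Z : 'I_n -> O -> (d.-tuple R * R)%type)
  (HZ : iid_sample Pr Z P)
  (fhat : O -> I)
  (Hfhat : forall w j, emp_risk Z (fam (fhat w)) w <= emp_risk Z (fam j) w)
  (delta : R) (delta_gt0 : 0 < delta) (delta_lt1 : delta < 1) :
  exists E : set O, measurable E /\ ((1 - delta)%:E <= Pr E)%E /\
    forall w, E w ->
      let A := Ahat mu Xi dtrain fstar (fam fbar) (fam (fhat w)) in
      let B := Binf Xi fstar (fam fbar) in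
      (Rtest mu Xi dtest fstar (fam (fhat w)) <=
       Cinf Xi dtrain dtest *
       (if (A < 0)%E then
          (B ^+ 2 + 224 * yinf ^+ 2 * ln (#|I|%:R / delta) / (3 * n%:R))%:E
            - 2%:E * A
        else
          (B ^+ 2 + 128 * yinf ^+ 2 * ln (#|I|%:R / delta) / (3 * n%:R))%:E
            - (Num.sqrt 3)%:E * A))%E.
Proof.
have [mp [_ intp]] := Htrain; have [mq [q0 intq]] := Htest.
have [mfs Hce] := Hfstar; have [mZ [ZP indep]] := HZ.
have p0 x : Xi x -> 0 <= dtrain x by move=> /Htrain_pos /ltW.
(* [Xi] carries the whole training marginal, so bounds assumed on [Xi] hold almost surely. *)
have XiP : {ae P, forall z, Xi z.1}.
  exists (~` Xi `*` setT); split.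
  - by apply: measurableX => //; exact: measurableC.
  - by rewrite HPmarg ?setICl ?integral_set0//; exact: measurableC.
  - by move=> z /= nz; split.
have [E [mE PE HE]] := sample_risk_bound n_gt0 Pr P Z mZ ZP indep I fam fbar
  fstar yinf delta yinf_gt0 delta_gt0 fam_meas mfs Hce
  (fun j => filterS (fun z => HFbd j z.1) XiP)
  (filterS (fun z => Hfstarbd z.1) XiP) Hybd.
exists E; split => //; split => // w Ew.
lazy zeta; set A := Ahat _ _ _ _ _ _; set B := Binf _ _ _.
set f := fam (fhat w) in A *; set g := fam fbar in A B *.
have marg h (mh : measurable_fun setT h) :
    (\int[P]_z (h z.1)%:E = \int[mu]_(x in Xi) (h x * dtrain x)%:E)%E.
  exact: marginal_integral.
have mf : measurable_fun setT f by exact: fam_meas.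
have mg : measurable_fun setT g by exact: fam_meas.
have mfg : measurable_fun setT (fun x => f x - g x) by exact: measurable_funB.
have mgs : measurable_fun setT (fun x => g x - fstar x) by exact: measurable_funB.
have mfs' : measurable_fun setT (fun x => f x - fstar x) by exact: measurable_funB.
have m1 : measurable_fun setT (fst : d.-tuple R * R -> d.-tuple R).
  exact: measurable_fst.
have intP (k : d.-tuple R -> R) C : measurable_fun setT k ->
    (forall x, Xi x -> `|k x| <= C) ->
    P.-integrable setT (EFin \o (fun z => k z.1)).
  move=> mk kC; apply: (@ae_bounded_integrable _ _ _ _ _ C).
    exact: measurableT_comp m1.
  by move: XiP; apply: filterS => z; exact: kC.
have gsbd x : Xi x -> `|g x - fstar x| <= 2 * yinf.
  move=> Xx; have := HFbd fbar x Xx; have := Hfstarbd x Xx; rewrite -/g !ler_norml.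
  by move=> /andP[? ?] /andP[? ?]; apply/andP; split; lra.
have fgbd x : Xi x -> `|f x - g x| <= 2 * yinf.
  move=> Xx; have := HFbd fbar x Xx; have := HFbd (fhat w) x Xx.
  rewrite -/f -/g !ler_norml.
  by move=> /andP[? ?] /andP[? ?]; apply/andP; split; lra.
have fsbd x : Xi x -> `|f x - fstar x| <= 2 * yinf.
  move=> Xx; have := Hfstarbd x Xx; have := HFbd (fhat w) x Xx.
  rewrite -/f !ler_norml.
  by move=> /andP[? ?] /andP[? ?]; apply/andP; split; lra.
pose V := \int[P]_z ((f z.1 - g z.1) ^+ 2).
pose a := \int[P]_z ((f z.1 - g z.1) * (g z.1 - fstar z.1)).
have AE : A = a%:E.
  rewrite /A /Ahat -(marg (fun x => (f x - g x) * (g x - fstar x))); last first.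
    exact: measurable_funM.
  rewrite fineK//; apply: integrable_fin_num => //.
  apply: (intP (fun x => (f x - g x) * (g x - fstar x)) (2 * yinf * (2 * yinf))).
    exact: measurable_funM.
  by move=> x Xx; rewrite normrM ler_pM ?gsbd ?fgbd.
have bnd : {ae P, forall z,
    [/\ `|f z.1| <= yinf, `|g z.1| <= yinf, `|fstar z.1| <= yinf & `|z.2| <= yinf]}.
  apply: filterS2 XiP Hybd => z Xz zy.
  by split => //; [exact: HFbd|exact: HFbd|exact: Hfstarbd].
have [_ _ risk] := excess_loss_moments P f g fstar yinf mf mg mfs Hce bnd.
have dev : V + 4 * a < 208 / 5 * (yinf ^+ 2 * ln (#|I|%:R / delta) / n%:R).
  apply: (HE _ _ Ew).
  by have := Hfhat w fbar; rewrite /emp_risk ler_pM2l ?invr_gt0 ?ltr0n.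
have V0 : 0 <= V by apply: Rintegral_ge0 => z _; exact: sqr_ge0.
pose s := yinf ^+ 2 * ln (#|I|%:R / delta) / n%:R.
(* The logarithm is positive since [delta < 1 <= #|I|]; hence [208 / 5 * s] lies below [128 / 3 * s]
   and [224 / 3 * s]. *)
have s0 : 0 < s.
  rewrite divr_gt0 ?ltr0n// mulr_gt0 ?exprn_gt0// ln_gt0//.
  rewrite ltr_pdivlMr// mul1r (lt_le_trans delta_lt1)// ler1n.
  by apply/card_gt0P; exists fbar.
have gB x : Xi x -> `|g x - fstar x| <= B.
  move=> Xx; apply: ub_le_sup; last by exists x.
  by exists (2 * yinf) => _ [u Xu <-]; exact: gsbd.
have igs : P.-integrable setT (EFin \o (fun z => (g z.1 - fstar z.1) ^+ 2)).
  apply: (intP (fun x => (g x - fstar x) ^+ 2) ((2 * yinf) ^+ 2)).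
    exact: measurable_funX.
  by move=> x Xx; rewrite normrX lerXn2r ?nnegrE ?gsbd// (le_trans _ (gsbd x Xx)).
have appr : \int[P]_z ((g z.1 - fstar z.1) ^+ 2) <= B ^+ 2.
  rewrite -lee_fin fineK; last exact: integrable_fin_num.
  apply: (@le_trans _ _ (\int[P]_z (B ^+ 2)%:E)%E).
    apply: ae_ge0_le_integral => //.
    - by move=> z _; rewrite lee_fin sqr_ge0.
    - exact: measurable_int igs.
    - by move=> z _; rewrite lee_fin sqr_ge0.
    move: XiP; apply: filterS => z Xz _; rewrite lee_fin -real_normK ?num_real//.
    by rewrite lerXn2r ?nnegrE ?gB// (le_trans _ (gB _ Xz)).
  by rewrite integral_cst// [X in (_ * X)%E]probability_setT mule1.
have Rtr : \int[P]_z ((f z.1 - fstar z.1) ^+ 2) <= V + 2 * a + B ^+ 2.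
  by rewrite risk lerD2l.
have Rtr0 : 0 <= \int[P]_z ((f z.1 - fstar z.1) ^+ 2).
  by apply: Rintegral_ge0 => z _; exact: sqr_ge0.
set bracket := (if _ then _ else _).
(* For [a < 0] this amounts to [V + 4 * a < 224 / 3 * s]. For [a >= 0] it follows from [V + (2 +
   sqrt 3) * a <= V + 4 * a < 128 / 3 * s]. *)
have [r rE rV] : exists2 r : R, bracket = r%:E & V + 2 * a + B ^+ 2 < r.
  rewrite /bracket AE lte_fin; case: ltP => a0.
    exists (B ^+ 2 + 224 * yinf ^+ 2 * ln (#|I|%:R / delta) / (3 * n%:R) - 2 * a).
      by [].
    have -> : 224 * yinf ^+ 2 * ln (#|I|%:R / delta) / (3 * n%:R) = 224 / 3 * s.
      by rewrite /s; field; rewrite pnatr_eq0 -lt0n.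
    by move: dev; rewrite -/s; clear -s0; lra.
  exists (B ^+ 2 + 128 * yinf ^+ 2 * ln (#|I|%:R / delta) / (3 * n%:R)
    - Num.sqrt 3 * a) => //.
  have -> : 128 * yinf ^+ 2 * ln (#|I|%:R / delta) / (3 * n%:R) = 128 / 3 * s.
    by rewrite /s; field; rewrite pnatr_eq0 -lt0n.
  have := ler_wpM2r a0 (@sqrt3_le2 R).
  by move: dev; rewrite -/s; clear -s0; lra.
rewrite rE.
have r0 : 0 < r by apply: le_lt_trans rV; exact: le_trans Rtr.
(* A density of total mass one has a nonempty domain; a point of it shows [Cinf] to be nonnegative,
   which excludes [-oo]. *)
have [x0 Xx0] : exists x, Xi x.
  apply: contrapT => /forallNP noX.
  have X0 : Xi = set0 by apply/seteqP; split => // x /noX.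
  by move: intp; rewrite X0 integral_set0 => /eqP; rewrite eq_sym onee_eq0.
have Cx x : Xi x -> ((`|dtest x / dtrain x|)%:E <= Cinf Xi dtrain dtest)%E.
  by move=> Xx; apply: ereal_sup_ubound; exists x.
case: (Cinf Xi dtrain dtest) Cx => [c| |] Cx.
(* For finite [c], the pointwise bound [dtest <= c * dtrain] on [Xi] makes the test risk at most [c]
   times the training risk. *)
- have c0 : 0 <= c by have := Cx x0 Xx0; rewrite lee_fin; exact: le_trans.
  apply: (@le_trans _ _
    (c%:E * (\int[P]_z ((f z.1 - fstar z.1) ^+ 2))%:E)%E); last first.
    by rewrite -!EFinM lee_fin ler_wpM2l// ltW// (le_lt_trans Rtr).
  have ifs : P.-integrable setT (EFin \o (fun z => (f z.1 - fstar z.1) ^+ 2)).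
    apply: (intP (fun x => (f x - fstar x) ^+ 2) ((2 * yinf) ^+ 2)).
      exact: measurable_funX.
    by move=> x Xx; rewrite normrX lerXn2r ?nnegrE ?fsbd// (le_trans _ (fsbd x Xx)).
  rewrite fineK; last exact: integrable_fin_num.
  rewrite (marg (fun x => (f x - fstar x) ^+ 2)); last exact: measurable_funX.
  have mfsX : measurable_fun Xi (fun x => (f x - fstar x) ^+ 2).
    by apply: measurable_funTS; exact: measurable_funX.
  rewrite -ge0_integralZl//; last 2 first.
  + by apply/measurable_EFinP; exact: measurable_funM.
  + by move=> x Xx; rewrite lee_fin mulr_ge0 ?sqr_ge0 ?p0.
  apply: ge0_le_integral => //.
  + by move=> x Xx; rewrite lee_fin mulr_ge0 ?sqr_ge0 ?q0.
  + by apply/measurable_EFinP; exact: measurable_funM.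
  + by apply: measurable_funeM; apply/measurable_EFinP; exact: measurable_funM.
  + move=> x Xx; rewrite -EFinM lee_fin mulrCA ler_wpM2l ?sqr_ge0//.
    rewrite -ler_pdivrMr ?Htrain_pos//.
    by have := Cx x Xx; rewrite lee_fin; apply: le_trans; exact: ler_norm.
- by rewrite gt0_mulye ?lte_fin// leey.
- by have := Cx x0 Xx0.
Qed.
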